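(* Let $G$ be a simple graph of order $n$ with minimum degree $\delta$ satisfying $1\le \delta\le \frac{n}{2}$ and average degree $d$. Let $0=\sigma_0\le\sigma_1\le\cdots\le\sigma_{n-1}$ be the Laplacian eigenvalues of $G$, and let $\theta\ge 0$ be a real number such that $|d-\sigma_i|\le\theta$ for all $i=1,\dots,n-1$. Then $$\kappa(G)\ge \delta-(2+2\sqrt{3})^2\frac{\theta^2}{\delta}.$$
   Context: The Laplacian matrix of $G$ is $L(G)=D(G)-A(G)$, where $D(G)$ is the diagonal matrix of vertex degrees and $A(G)$ the adjacency matrix; its eigenvalues (the Laplacian eigenvalues) are ordered $0=\sigma_0\le\sigma_1\le\cdots\le\sigma_{n-1}$. The average degree is $d=\frac{1}{n}\sum_{v}d_v$. $\kappa(G)$ denotes the vertex connectivity of $G$: the minimum number of vertices whose deletion makes $G$ disconnected. *)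

(* Defs.v *)
From mathcomp Require Import all_boot all_order all_algebra.
From mathcomp Require Import reals.

Set Implicit Arguments.
Unset Strict Implicit.
Unset Printing Implicit Defensive.

Import Order.TTheory GRing.Theory Num.Theory.
Local Open Scope ring_scope.

(* A simple graph is a symmetric irreflexive relation on a finite type; the
   definitions below take only the relation, the two hypotheses being
   supplied where the definitions are used. *)

Definition degree (T : finType) (e : rel T) (v : T) : nat := #|[set w | e v w]|.

(* Degrees are smaller than #|T|, so the neutral element does not affect the
   minimum unless T is empty. *)
Definition min_degree (T : finType) (e : rel T) : nat :=
  \big[minn/#|T|]_(v : T) degree e v.

Definition avg_degree (R : realType) (T : finType) (e : rel T) : R :=
  (\sum_(v : T) (degree e v)%:R) / #|T|%:R.

Definition del_rel (T : finType) (e : rel T) (S : {set T}) : rel T :=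
  [rel x y | [&& x \notin S, y \notin S & e x y]].

Definition disconnects (T : finType) (e : rel T) (S : {set T}) : bool :=
  [exists x in ~: S, exists y in ~: S, ~~ connect (del_rel e S) x y].

(* A disconnecting set leaves at least two vertices, so #|T|.-1 is the value
   only when no set disconnects, i.e., for complete graphs, where it is the
   usual convention. *)
Definition vertex_connectivity (T : finType) (e : rel T) : nat :=
  \big[minn/#|T|.-1]_(S : {set T} | disconnects e S) #|S|.

(* Rows and columns are indexed by the enumeration of the vertices. *)
Definition adjacency_mx (R : realType) (T : finType) (e : rel T) : 'M[R]_#|T| :=
  \matrix_(i, j) (e (enum_val i) (enum_val j))%:R.

Definition degree_mx (R : realType) (T : finType) (e : rel T) : 'M[R]_#|T| :=
  diag_mx (\row_i (degree e (enum_val i))%:R).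

Definition laplacian_mx (R : realType) (T : finType) (e : rel T) : 'M[R]_#|T| :=
  degree_mx R e - adjacency_mx R e.

(* s lists the eigenvalues of A with multiplicity, in nondecreasing order;
   this determines s, and forces size s = n. *)
Definition ordered_spectrum (R : realType) (n : nat) (A : 'M[R]_n) (s : seq R)
    : Prop :=
  sorted <=%R s /\ char_poly A = \prod_(x <- s) ('X - x%:P).

(* Main.v *)
Require Import Defs.
From mathcomp Require Import all_boot all_order all_algebra.
From mathcomp Require Import reals complex.
From mathcomp Require Import ring lra.

(* Let X and Y be the two sides of a vertex cut S, with |X| <= |Y|, and let v be
   the indicator function of Y, shifted by |Y|/n to be orthogonal to the constants.
   If theta < d then 0 is a simple Laplacian eigenvalue, so the spectral theorem
   gives |(L - d) v|^2 <= theta^2 |v|^2. As no edge joins X to Y, (L - d) v is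
   constantly d |Y|/n on X, whence d^2 |X| |Y| <= theta^2 n (n - |Y|). Every
   neighbour of a vertex of X lies in X or S, so delta <= |X| + |S|; together with
   n <= 4 |Y| this forces |S| >= delta - 16 theta^2 / delta, and
   16 <= (2 + 2 sqrt 3)^2. *)

Set Implicit Arguments.
Unset Strict Implicit.
Unset Printing Implicit Defensive.

Import Order.TTheory GRing.Theory Num.Theory.
Local Open Scope ring_scope.
Local Open Scope sesquilinear_scope.

(** * Norm bounds for normal and symmetric matrices *)

Lemma char_poly_conj (F : fieldType) n (P A : 'M[F]_n) :
  P \in unitmx -> char_poly (invmx P *m A *m P) = char_poly A.
Proof.
move=> uP; rewrite /char_poly.
have -> : char_poly_mx (invmx P *m A *m P) =
    map_mx polyC (invmx P) *m char_poly_mx A *m map_mx polyC P.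
  rewrite /char_poly_mx mulmxBr mulmxBl !map_mxM /=; congr (_ - _).
  by rewrite scalar_mxC -mulmxA -map_mxM mulVmx // map_mx1 mulmx1.
rewrite !det_mulmx mulrC mulrA -det_mulmx -map_mxM mulmxV // map_mx1.
by rewrite det1 mul1r.
Qed.

(** In a unitary eigenbasis [A - c] scales each coordinate of [v] by an eigenvalue minus [c]. Only
    the eigenvalue [a] may be far from [c]; it is simple, so its eigenspace is spanned by [z], and
    [v] has no component there. *)
Lemma normalmx_sqnorm_le (C : numClosedFieldType) n (A : 'M[C]_n) (s : seq C)
    (a c t : C) (z v : 'rV[C]_n) :
  A \is normalmx -> char_poly A = \prod_(x <- s) ('X - x%:P) ->
  (count_mem a s <= 1)%N -> (forall x, x \in s -> x != a -> `|c - x| <= t) ->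
  z != 0 -> z *m A = a *: z -> v *m z^t* = 0 ->
  ((v *m A - c *: v) *m (v *m A - c *: v)^t*) 0 0 <= t ^+ 2 * (v *m v^t*) 0 0.
Proof.
move=> /orthomx_spectralP; set P := spectralmx A; set D := spectral_diag A.
have uP : P \is unitarymx := spectral_unitarymx A.
have unP := unitarymx_unit uP.
move=> defA chA sim near z0 zA vz.
(* Both lists are the roots of the characteristic polynomial, so hypotheses on [s] transfer to the
   diagonal [D]. *)
have chD : perm_eq s [seq D 0 i | i <- enum 'I_n].
  apply: prod_XsubC_eq; rewrite -chA defA char_poly_conj //.
  rewrite char_poly_trig ?diag_mx_is_trig // big_map big_enum /=.
  by apply: eq_bigr => i _; rewrite !mxE eqxx.
pose y := z *m P^t*; pose x := v *m P^t*.
have yP : z = y *m P by rewrite mulmxKtV.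
have xP : v = x *m P by rewrite mulmxKtV.
move: (y) (x) yP xP => {}y {}x yP xP.
have PPt : P *m P^t* = 1%:M by apply/unitarymxP.
have PA : P *m A = diag_mx D *m P by rewrite defA !mulmxA mulmxV // mul1mx.
(* [y] and [x] are the coordinates of [z] and [v] in the eigenbasis: [y] is
   supported on the single index [i0] carrying [a], so [x] vanishes there. *)
have yD i : D 0 i != a -> y 0 i = 0.
  move=> Da; have : y *m diag_mx D = a *: y.
    have := zA; rewrite yP -mulmxA PA mulmxA scalemxAl.
    by move/(congr1 (fun M => M *m P^t*)); rewrite /= !mulmxtVK.
  move/rowP/(_ i); rewrite mul_mx_diag !mxE => /eqP.
  by rewrite -subr_eq0 mulrC -mulrBl mulf_eq0 subr_eq0 (negPf Da) => /eqP.
have y0 : y != 0 by apply: contraNneq z0 => y0; rewrite yP y0 mul0mx.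
have [i0 yi0] : exists i, y 0 i != 0.
  apply/existsP; apply: contraNT y0; rewrite negb_exists => /forallP h.
  by apply/eqP/rowP=> i; rewrite [RHS]mxE; apply/eqP; exact: negbNE (h i).
have Di0 : D 0 i0 = a by apply/eqP; apply: contraNT yi0 => /yD ->.
(* A second index carrying [a] would give [a] multiplicity at least 2 in [s]. *)
have Di i : i != i0 -> D 0 i != a.
  move=> ii; apply/negP => /eqP Dia; move: sim; rewrite (permP chD) count_map.
  rewrite -size_filter leqNgt => /negP; apply.
  rewrite (_ : 2%N = size [:: i; i0])//; apply: uniq_leq_size.
    by rewrite /= inE ii.
  move=> j; rewrite !inE mem_filter mem_enum andbT /=.
  by case/orP=> /eqP ->; apply/eqP.
have xi0 : x 0 i0 = 0.
  have : (x *m y^t*) 0 0 = 0.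
    have : x *m y^t* = 0.
      by rewrite -vz xP yP trmx_mul map_mxM mulmxA -(mulmxA x) PPt mulmx1.
    by move=> ->; rewrite mxE.
  rewrite mxE (bigD1 i0) //= big1 ?addr0 => [|i ii].
    by rewrite !mxE => /eqP; rewrite mulf_eq0 conjC_eq0 (negPf yi0) orbF => /eqP.
  by rewrite !mxE yD ?Di // conjC0 mulr0.
have sqn u : (u *m P) *m (u *m P)^t* = u *m u^t* :> 'M_1.
  by rewrite trmx_mul map_mxM mulmxA -(mulmxA u) PPt mulmx1.
have wE : v *m A - c *: v = (x *m diag_mx D - c *: x) *m P.
  by rewrite [v]xP -mulmxA PA mulmxBl scalemxAl mulmxA.
rewrite wE [v]xP !sqn mul_mx_diag !mxE mulr_sumr; apply: ler_sum => i _.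
rewrite !mxE; have [->|ii] := eqVneq i i0.
  by rewrite xi0 !(mul0r, mulr0) subrr mul0r.
have le_t : `|D 0 i - c| <= t.
  by rewrite distrC near ?Di // (perm_mem chD) map_f // mem_enum.
rewrite -!normCK [X in X - _]mulrC -mulrBl normrM exprMn ler_wpM2r ?exprn_ge0//.
by rewrite ler_pXn2r ?nnegrE// (le_trans (normr_ge0 _) le_t).
Qed.

(** Embedding into [R[i]] makes [A] normal; conjugation fixes the image of [R], so both norms and
    the orthogonality are unchanged. *)
Lemma symmetric_sqnorm_le (R : rcfType) n (A : 'M[R]_n) (s : seq R)
    (a c t : R) (z v : 'rV[R]_n) :
  A^T = A -> char_poly A = \prod_(x <- s) ('X - x%:P) ->
  (count_mem a s <= 1)%N -> (forall x, x \in s -> x != a -> `|c - x| <= t) ->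
  z != 0 -> z *m A = a *: z -> v *m z^T = 0 ->
  \sum_i ((v *m A) 0 i - c * v 0 i) ^+ 2 <= t ^+ 2 * \sum_i v 0 i ^+ 2.
Proof.
move=> symA chA sim near z0 zA vz.
under eq_bigr => i _.
  have -> : (v *m A) 0 i - c * v 0 i = (v *m A - c *: v) 0 i by rewrite [in RHS]mxE !mxE.
  over.
pose f := real_complex R.
have fJ m p (M : 'M[R]_(m, p)) : map_mx f M ^ Num.conj = map_mx f M.
  by apply/matrixP=> i j; rewrite !mxE; apply/CrealP; rewrite complex_real.
have fz (u : 'rV[R]_n) : (map_mx f u *m (map_mx f u)^t*) 0 0 = f (\sum_i u 0 i ^+ 2).
  rewrite -map_trmx fJ map_trmx -map_mxM !mxE; congr f.
  by apply: eq_bigr => i _; rewrite mxE.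
have := @normalmx_sqnorm_le R[i] n (map_mx f A) [seq f x | x <- s] (f a) (f c) (f t)
   (map_mx f z) (map_mx f v).
have -> : map_mx f v *m map_mx f A - f c *: map_mx f v = map_mx f (v *m A - c *: v).
  by rewrite map_mxB map_mxZ map_mxM.
rewrite !fz -rmorphXn -rmorphM /= lecR.
apply.
- by apply/normalmxP; rewrite -map_trmx fJ map_trmx symA.
- by rewrite -map_char_poly chA map_prod_XsubC big_map.
- by rewrite count_map (eq_count (a2 := pred1 a)) // => x /=; rewrite (inj_eq (@complexI _)).
- move=> _ /mapP[x xs ->]; rewrite (inj_eq (@complexI _)) => xa.
  by rewrite -rmorphB /= normc_def /= expr0n addr0 sqrtr_sqr lecR near.
- by rewrite map_mx_eq0.
- by rewrite -map_mxM zA map_mxZ.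
- by rewrite -map_trmx fJ map_trmx -map_mxM vz map_mx0.
Qed.

(** * Degrees, and the Laplacian as an operator on functions *)

Lemma min_degree_le (T : finType) (e : rel T) (x : T) :
  (min_degree e <= degree e x)%N.
Proof.
rewrite /min_degree; have := mem_index_enum x.
elim: (index_enum T) => [//|y r IHr]; rewrite inE big_cons.
by case/predU1P=> [->|/IHr]; rewrite geq_min ?leqnn // => ->; rewrite orbT.
Qed.

Lemma min_degree_le_avg (R : realType) (T : finType) (e : rel T) :
  (0 < #|T|)%N -> (min_degree e)%:R <= avg_degree R e.
Proof.
move=> T0; rewrite /avg_degree ler_pdivlMr ?ltr0n // -natrM -natr_sum ler_nat.
rewrite mulnC -sum_nat_const; apply: leq_sum => x _; exact: min_degree_le.
Qed.

Lemma sum_enum_val (V : nmodType) (T : finType) (F : T -> V) :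
  \sum_(i < #|T|) F (enum_val i) = \sum_x F x.
Proof.
rewrite [RHS](reindex_onto enum_val enum_rank) => [|x _]; last exact: enum_rankK.
by apply: eq_bigl => i; rewrite enum_valK eqxx.
Qed.

Lemma laplacian_row (R : realType) (T : finType) (e : rel T) (g : T -> R) :
  symmetric e ->
  (\row_i g (enum_val i)) *m laplacian_mx R e =
  \row_i \sum_(y | e (enum_val i) y) (g (enum_val i) - g y).
Proof.
move=> e_sym; apply/rowP=> i; rewrite /laplacian_mx mulmxBr !mxE.
rewrite /degree_mx (bigD1 i) //= big1 => [|j ji]; last first.
  by rewrite !mxE (negPf ji) mulr0.
rewrite !mxE eqxx mulr1n addr0 sumrB; congr (_ - _).
  by rewrite sumr_const mulr_natr /degree cardsE.
rewrite [RHS]big_mkcond -[RHS]sum_enum_val; apply: eq_bigr => j _.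
by rewrite !mxE e_sym; case: ifP => _; rewrite ?mulr1 ?mulr0.
Qed.

(** * Spectral gap and separated sets *)

Section SpectralGap.

Variables (R : realType) (T : finType) (e : rel T) (sigma : seq R) (theta : R).
Hypothesis e_sym : symmetric e.
Hypothesis sigma_spec : ordered_spectrum (laplacian_mx R e) sigma.
Hypothesis sigma_near : forall i : nat, (1 <= i <= #|T|.-1)%N ->
  `|avg_degree R e - sigma`_i| <= theta.
Hypothesis theta_lt : theta < avg_degree R e.

Lemma laplacian_sqnorm_le (g : T -> R) : \sum_x g x = 0 ->
  \sum_x ((\sum_(y | e x y) (g x - g y)) - avg_degree R e * g x) ^+ 2
    <= theta ^+ 2 * \sum_x g x ^+ 2.
Proof.
move=> g0.
have [T0|T_gt0] := posnP #|T|.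
  by rewrite !big1 ?mulr0 // => x; have := card0_eq T0 x.
have [_ chL] := sigma_spec.
pose z : 'rV[R]_#|T| := \row_i 1.
have z0 : z != 0.
  apply/eqP => /rowP/(_ (Ordinal T_gt0)); rewrite !mxE => /eqP.
  by rewrite oner_eq0.
have zL : z *m laplacian_mx R e = 0 *: z.
  rewrite scale0r /z (laplacian_row (fun=> 1)) //.
  by apply/rowP => i; rewrite !mxE big1 // => y _; rewrite subrr.
(* Comparing degrees of the characteristic polynomial; the indices in [sigma_near] are then exactly
   those of the tail [s']. *)
have sz : size sigma = #|T|.
  by apply/eqP; rewrite -eqSS -(size_char_poly (laplacian_mx R e)) chL size_prod_XsubC.
have sigma0 : 0 \in sigma.
  rewrite -root_prod_XsubC -chL -eigenvalue_root_char.
  by apply/eigenvalueP; exists z.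
case: sigma sigma_near sz chL sigma0 => [|s0 s'] near sz chL.
  by rewrite in_nil.
have near' x : x \in s' -> `|avg_degree R e - x| <= theta.
  move=> /(nthP 0)[i i_lt <-]; apply: (near i.+1).
  by rewrite -sz.
(* A zero in the tail would force [avg_degree R e <= theta]. Hence 0, an eigenvalue by [z], is the
   head and is simple. *)
have s'0 : 0 \notin s'.
  apply/negP => /near'; rewrite subr0 => /(le_trans (ler_norm _)).
  by rewrite leNgt theta_lt.
rewrite inE (negPf s'0) orbF => /eqP s00.
pose v : 'rV[R]_#|T| := \row_i g (enum_val i).
have <- : \sum_i ((v *m laplacian_mx R e) 0 i - avg_degree R e * v 0 i) ^+ 2 =
    \sum_x ((\sum_(y | e x y) (g x - g y)) - avg_degree R e * g x) ^+ 2.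
  rewrite laplacian_row // -[RHS]sum_enum_val.
  by apply: eq_bigr => i _; rewrite !mxE.
have <- : \sum_i v 0 i ^+ 2 = \sum_x g x ^+ 2.
  by rewrite -[RHS]sum_enum_val; apply: eq_bigr => i _; rewrite mxE.
apply: (symmetric_sqnorm_le _ chL _ _ z0 zL).
- apply/matrixP=> i j; rewrite !mxE e_sym eq_sym.
  by case: eqVneq => [->|].
- by rewrite /= -s00 eqxx (count_memPn s'0).
- by move=> x; rewrite inE -s00 => /orP[->//|/near'].
- apply/rowP => i; rewrite !mxE -[RHS]g0 -(sum_enum_val g).
  by apply: eq_bigr => j _; rewrite !mxE mulr1.
Qed.

Lemma separated_card_le (X Y : {set T}) :
  [disjoint X & Y] -> {in X & Y, forall x y, ~~ e x y} ->
  avg_degree R e ^+ 2 * (#|X|%:R * #|Y|%:R)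
    <= theta ^+ 2 * (#|T|%:R * (#|T|%:R - #|Y|%:R)).
Proof.
move=> disXY noe; set d := avg_degree R e; set b : R := #|Y|%:R; set n : R := #|T|%:R.
have [Y0|[y0 y0Y]] := set_0Vmem Y.
  by rewrite /b Y0 cards0 subr0 !mulr0 mulr_ge0 ?sqr_ge0 // -expr2 sqr_ge0.
have n_gt0 : 0 < n by rewrite ltr0n; apply/card_gt0P; exists y0.
have b_gt0 : 0 < b by rewrite ltr0n; apply/card_gt0P; exists y0.
have sumY : \sum_x (x \in Y)%:R = b.
  rewrite /b -sum1_card [in RHS]big_mkcond natr_sum.
  by apply: eq_bigr => x _; case: (x \in Y).
pose g x : R := (x \in Y)%:R - b / n.
have g0 : \sum_x g x = 0.
  by rewrite sumrB sumY sumr_const -mulr_natr divfK ?subrr // gt_eqF.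
(* An indicator is its own square, so [g x ^+ 2] is affine in it. *)
have sqg : \sum_x g x ^+ 2 = b * (n - b) / n.
  transitivity (\sum_x ((1 - 2 * (b / n)) * (x \in Y)%:R + (b / n) ^+ 2)).
    by apply: eq_bigr => x _; rewrite /g; case: (x \in Y) => /=; ring.
  rewrite big_split /= -mulr_sumr sumY sumr_const -mulr_natr -/n.
  by field; rewrite gt_eqF.
have valX x : x \in X -> (\sum_(y | e x y) (g x - g y)) - d * g x = d * (b / n).
  move=> xX; have xY : x \in Y = false by apply: (disjointFr disXY).
  rewrite big1 => [|y exy].
    by rewrite /g xY !sub0r mulrN opprK.
  have yY : y \in Y = false.
    by apply/negbTE/negP => yY; move: (noe x y xX yY); rewrite exy.
  by rewrite /g xY yY subrr.
have := laplacian_sqnorm_le g0; rewrite sqg -/d => le_g.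
(* Only the terms over [X] are kept; the others are nonnegative squares. *)
have : #|X|%:R * (d * (b / n)) ^+ 2 <= theta ^+ 2 * (b * (n - b) / n).
  apply: le_trans le_g; rewrite (bigID (mem X)) /= -[leLHS]addr0 lerD //.
    rewrite (eq_bigr (fun=> (d * (b / n)) ^+ 2)) => [|x xX]; last by rewrite valX.
    by rewrite sumr_const mulr_natl.
  by apply: sumr_ge0 => x _; rewrite sqr_ge0.
have k_gt0 : 0 < n ^+ 2 / b by rewrite divr_gt0 ?exprn_gt0.
rewrite -(ler_pM2r k_gt0).
have -> : #|X|%:R * (d * (b / n)) ^+ 2 * (n ^+ 2 / b) = d ^+ 2 * (#|X|%:R * b).
  by field; rewrite !gt_eqF.
suff -> : theta ^+ 2 * (b * (n - b) / n) * (n ^+ 2 / b) =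
  theta ^+ 2 * (n * (n - b)) by [].
by field; rewrite !gt_eqF.
Qed.

End SpectralGap.

(** * From separated sets to vertex connectivity *)

Lemma small_separator_absurd (R : realFieldType) (a b n s D d q : R) :
  0 < a -> 0 < D -> 0 <= s -> 0 <= q -> D <= d -> D <= n / 2 ->
  a <= b -> a + b + s = n -> D <= a + s -> 16 * q < (D - s) * D ->
  d ^+ 2 * (a * b) <= q * (n * (n - b)) -> False.
Proof.
move=> a0 D0 s0 q0 Dd Dn ab nE Das hq mix.
have sD : s < D.
  by rewrite -subr_gt0 -(pmulr_lgt0 _ D0); apply: le_lt_trans hq; rewrite mulr_ge0.
(* Since [s < D <= n / 2], more than half of [n] remains for [a + b], and [b] is the larger part. *)
have nb : n <= 4 * b by lra.
have b0 : 0 < b by lra.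
have d2 : D ^+ 2 * a <= d ^+ 2 * a by rewrite ler_pM2r // ler_sqr ?nnegrE; lra.
have mix4 : d ^+ 2 * a <= 4 * q * (a + s).
  rewrite -(ler_pM2r b0) -[_ * a * b]mulrA; apply: (le_trans mix).
  have -> : n - b = a + s by lra.
  have -> : 4 * q * (a + s) * b = q * (4 * b * (a + s)) by ring.
  by rewrite ler_wpM2l // ler_wpM2r //; lra.
(* Both [4 * q * a] and [4 * q * s] are at most a quarter of [D ^+ 2 * a], the latter strictly since
   [s < D] and [D - s <= a]. This contradicts [mix4], whose left side is at least [D ^+ 2 * a]. *)
have qa : 16 * q * a <= D ^+ 2 * a.
  rewrite ler_pM2r //; apply: (le_trans (ltW hq)).
  by rewrite expr2 ler_pM2r //; lra.
have qs : 16 * q * s <= 16 * q * D by rewrite ler_wpM2l //; lra.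
have qD : 16 * q * D < D ^+ 2 * a.
  rewrite (_ : D ^+ 2 * a = D * a * D); last by ring.
  rewrite ltr_pM2r //; apply: (lt_le_trans hq).
  by rewrite mulrC ler_pM2l //; lra.
have : 0 < D ^+ 2 * a by rewrite mulr_gt0 ?exprn_gt0.
lra.
Qed.

Lemma separated_rest_ge (R : realType) (T : finType) (e : rel T)
    (sigma : seq R) (theta : R) (X Y : {set T}) :
  symmetric e ->
  (0 < min_degree e)%N -> (min_degree e)%:R <= #|T|%:R / 2 :> R ->
  ordered_spectrum (laplacian_mx R e) sigma ->
  0 <= theta ->
  (forall i : nat, (1 <= i <= #|T|.-1)%N ->
     `|avg_degree R e - sigma`_i| <= theta) ->
  [disjoint X & Y] -> {in X & Y, forall x y, ~~ e x y} ->
  X != set0 -> (#|X| <= #|Y|)%N ->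
  (min_degree e)%:R - 16 * (theta ^+ 2 / (min_degree e)%:R)
    <= #|~: (X :|: Y)|%:R :> R.
Proof.
move=> e_sym delta_gt0 delta_le spec theta_ge0 near disXY noe X0 leXY.
have T_gt0 : (0 < #|T|)%N.
  by case/set0Pn: X0 => x _; apply/card_gt0P; exists x.
have := min_degree_le_avg R e T_gt0; set d := avg_degree R e => le_d.
have delta_leX : (min_degree e <= #|X| + #|~: (X :|: Y)|)%N.
  case/set0Pn: X0 => x xX; apply: leq_trans (min_degree_le e x) _.
  rewrite -cardsUI; apply: leq_trans (leq_addr _ _); apply: subset_leq_card.
  apply/subsetP => y; rewrite !inE => exy; case: (boolP (y \in X)) => //= yX.
  by apply/negP => yY; move: (noe x y xX yY); rewrite exy.
have cardT : (#|X| + #|Y| + #|~: (X :|: Y)|)%N = #|T|.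
  by rewrite -[RHS](cardsC (X :|: Y)) cardsU disjoint_setI0 // cards0 subn0.
rewrite lerBlDr -lerBlDl leNgt; apply/negP.
have d0 : 0 < (min_degree e)%:R :> R by rewrite ltr0n.
have a0 : 0 < #|X|%:R :> R by rewrite ltr0n card_gt0.
move: delta_leX leXY cardT delta_le le_d d0 a0.
rewrite -(ler_nat R) natrD -(ler_nat R) => h1 h2 /(congr1 (GRing.natmul (1 : R))).
rewrite !natrD => h3 h4 le_d d0 a0; rewrite mulrA ltr_pdivrMr // => h.
(* The negated bound [h] gives 16 theta^2 < delta^2, so theta < delta <= d: the condition for the
   spectral gap comes for free. *)
have theta_lt : theta < d.
  apply: lt_le_trans le_d; rewrite ltNge; apply/negP => le_t.
  have : (min_degree e)%:R ^+ 2 <= theta ^+ 2 by rewrite ler_sqr ?nnegrE.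
  have : 0 <= #|~: (X :|: Y)|%:R * (min_degree e)%:R :> R by rewrite mulr_ge0.
  have : 0 < (min_degree e)%:R ^+ 2 :> R by rewrite exprn_gt0.
  move: h; rewrite mulrBl -expr2; lra.
have := separated_card_le e_sym spec near theta_lt disXY noe.
exact: small_separator_absurd a0 d0 (ler0n _ _) (sqr_ge0 _) le_d h4 h2 h3 h1 h.
Qed.


Theorem theorem2p1 (R : realType) (T : finType) (e : rel T)
    (e_sym : symmetric e) (e_irr : irreflexive e)
    (delta_ge1 : (1 <= min_degree e)%N)
    (delta_le : (min_degree e)%:R <= #|T|%:R / 2 :> R)
    (sigma : seq R)
    (sigma_spec : ordered_spectrum (laplacian_mx R e) sigma)
    (theta : R) (theta_ge0 : 0 <= theta)
    (sigma_near : forall i : nat, (1 <= i <= #|T|.-1)%N ->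
       `|avg_degree R e - sigma`_i| <= theta) :
  (vertex_connectivity e)%:R >=
    (min_degree e)%:R
    - (2 + 2 * Num.sqrt 3) ^+ 2 * (theta ^+ 2 / (min_degree e)%:R) :> R.
Proof.
set D : R := (min_degree e)%:R; set k := (2 + _) ^+ 2.
have D0 : 0 < D by rewrite ltr0n.
(* Expanded, [k] is 16 + 8 sqrt 3. *)
have k16 : 16 <= k.
  have h3 : 0 <= Num.sqrt 3 :> R := sqrtr_ge0 _.
  have : Num.sqrt 3 ^+ 2 = 3 :> R by rewrite sqr_sqrtr.
  by rewrite /k; nra.
have q0 : 0 <= theta ^+ 2 / D by rewrite divr_ge0 ?sqr_ge0 ?ltW.
apply: (@le_trans _ _ (D - 16 * (theta ^+ 2 / D))).
  by rewrite lerD2l lerN2 ler_wpM2r.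
rewrite /vertex_connectivity; elim/big_ind: _ => [|m1 m2 h1 h2|S].
(* The neutral value [#|T|.-1] obeys the bound too: n >= 2 delta >= 2, so delta <= n / 2 <= n -
   1. *)
- apply: (@le_trans _ _ D); first by rewrite gerBl mulr_ge0.
  have n2 : 2 <= #|T|%:R :> R.
    have : 1 <= D by rewrite ler1n.
    by move: delta_le; rewrite -/D; lra.
  have n1 : (0 < #|T|)%N by rewrite -(ltr0n R); lra.
  have : #|T|.-1%:R = #|T|%:R - 1 :> R by rewrite -subn1 natrB.
  by move: delta_le; rewrite -/D; lra.
- by rewrite /minn; case: ifP.
case/exists_inP=> x xS /exists_inP[y yS xy].
(* [A] is the component of [x] once [S] is deleted; [B] is everything else outside [S] and contains
   [y]. *)
pose A := [set z in ~: S | connect (del_rel e S) x z].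
pose B := ~: S :\: A.
have sepAB : {in A & B, forall z w, ~~ e z w}.
  move=> z w; rewrite !inE => /andP[zS xz] /andP[wA wS].
  apply: contraNN wA => zw; rewrite wS (connect_trans xz) // connect1 //=.
  exact/and3P.
have disAB : [disjoint A & B].
  by apply/pred0P => z; rewrite /= !inE andbA andbN.
have AB : ~: (A :|: B) = S.
  by apply/setP=> z; rewrite !inE; case: (z \in S) (connect _ x z) => [] [].
(* Either side may be the smaller one; [x] or [y] shows that it is nonempty. *)
have [leAB|/ltnW leBA] := leqP #|A| #|B|.
  rewrite -AB; apply: (separated_rest_ge e_sym _ _ sigma_spec) => //.
  by apply/set0Pn; exists x; move: xS; rewrite !inE connect0 andbT.
rewrite -AB setUC; apply: (separated_rest_ge e_sym _ _ sigma_spec) => //.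
- by rewrite disjoint_sym.
- by move=> z w zB wA; rewrite e_sym sepAB.
- by apply/set0Pn; exists y; move: yS; rewrite !inE (negPf xy) andbF => ->.
Qed.
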